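(* Let $\mathbf{G}$ be a finite RDF graph and let $\mathbf{S} = (\mathbf{L}, \mathbf{def})$ be a shapes schema with finitely many labels that admits a stratification. For any node $n \in \mathrm{Nodes}(\mathbf{G})$ and any shape label $L \in \mathbf{L}$, the evaluation of $\mathit{prove}(n, L, [\,])$ (where $[\,]$ is the empty stack) terminates, and it returns true if $(n,L) \in \mathit{Typing}(\mathbf{G}, \mathbf{S})$ and false otherwise.
   Context: **RDF graphs.** Let $\mathsf{IRI}$, $\mathsf{Lit}$, $\mathsf{Blank}$ be three pairwise disjoint sets (IRIs, literals, blank nodes). An RDF graph $\mathbf{G}$ is a set of triples $(s,p,o) \in (\mathsf{IRI} \cup \mathsf{Blank}) \times \mathsf{IRI} \times (\mathsf{IRI} \cup \mathsf{Lit} \cup \mathsf{Blank})$. $\mathrm{Nodes}(\mathbf{G})$ is the set of elements occurring as subject ($s$) or object ($o$) of some triple of $\mathbf{G}$. The neighbourhood of a node $n$ is $\mathit{neigh}(n) = \{(s,p,o) \in \mathbf{G} \mid s = n\}$. $N = N_1 \uplus N_2$ means $N = N_1 \cup N_2$ and $N_1 \cap N_2 = \emptyset$ (similarly for $k$ pairwise disjoint sets). **Shapes schemas.** A shapes schema is a pair $\mathbf{S} = (\mathbf{L}, \mathbf{def})$, where $\mathbf{L}$ is a set of shape labels and $\mathbf{def}$ maps every label of $\mathbf{L}$ to a shape expression. Let $\_b$ be a special constant. Shape expressions are given by $S ::= V \mid E \mid S \;\mathsf{AND}\; S \mid S \;\mathsf{OR}\; S \mid \mathsf{NOT}\; S$,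 where $V$ (a value description) is a subset of $\mathsf{IRI} \cup \mathsf{Lit} \cup \{\_b\}$ and $E$ (a neighbourhood description) is a triple expression. Triple expressions are given by $E ::= P\,@L \mid \mathsf{EMPTY} \mid (E \mid E) \mid E\,;E \mid E[\mathit{min};\mathit{max}]$, where $P \subseteq \mathsf{IRI}$, $L \in \mathbf{L}$, $\mathit{min}$ is a natural number and $\mathit{max}$ is a natural number or $*$ (unbounded). Membership in the sets $V$ and $P$ is assumed to be decidable. Standing assumption: all shape expressions $\mathbf{def}(L)$ are in disjunctive normal form; in particular $\mathsf{NOT}$ is applied only to atomic sub-expressions (value descriptions or triple expressions). **Typings and satisfaction.** A typing of $\mathbf{G}$ by $\mathbf{S}$ is a subset of $\mathrm{Nodes}(\mathbf{G}) \times \mathbf{L}$. For a typing $t$ and a set of triples $N$, the relation $t, N \vDash E$ is defined recursively on $E$: - $t, N \vDash P@L$ iff $N = \{(s,p,o)\}$ is a singleton with $p \in P$ and $(o,L) \in t$; - $t, N \vDash \mathsf{EMPTY}$ iff $N = \emptyset$; - $t, N \vDash E_1 \mid E_2$ iff $t,N \vDash E_1$ or $t,N \vDash E_2$; - $t, N \vDash E_1 ; E_2$ iff $N = N_1 \uplus N_2$ for some $N_1, N_2$ with $t,N_1 \vDash E_1$ and $t,N_2 \vDash E_2$; - $t, N \vDash E[\mathit{min};\mathit{max}]$ iff for some natural $k$ with $\mathit{min} \le k \le \mathit{max}$ (no upper bound if $\mathit{max} = *$), $N = N_1 \uplus \dots \uplus N_k$ with $t, N_j \vDash E$ for all $1 \le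 j \le k$ ($k=0$ being possible only when $N = \emptyset$). For a node $n$, the relation $t, n \vdash S$ is defined recursively on $S$: - $t, n \vdash V$ iff $n \in V$, or $n \in \mathsf{Blank}$ and $\_b \in V$; - $t, n \vdash E$ iff $t, \mathit{neigh}(n) \vDash E$; - $\mathsf{AND}$ and $\mathsf{OR}$ are interpreted as conjunction and disjunction; - $t, n \vdash \mathsf{NOT}\,S$ iff not $t, n \vdash S$. A typing $t$ is a *correct typing* of $\mathbf{G}$ by $\mathbf{S}$ if $t, n \vdash \mathbf{def}(L)$ for every $(n,L) \in t$. **Stratification.** For labels $L_1, L_2$: $\mathit{dep}^-(L_1,L_2)$ holds iff $L_2$ appears in $\mathbf{def}(L_1)$ under an occurrence of $\mathsf{NOT}$; $\mathit{dep}^+(L_1,L_2)$ holds iff $L_2$ appears in $\mathbf{def}(L_1)$ but never under an occurrence of $\mathsf{NOT}$. A stratification of $\mathbf{S}$ with $k$ strata ($k \ge 1$) is a map $\mathit{strat} : \mathbf{L} \to [1;k]$ such that $\mathit{dep}^-(L_1,L_2)$ implies $\mathit{strat}(L_1) > \mathit{strat}(L_2)$, and $\mathit{dep}^+(L_1,L_2)$ implies $\mathit{strat}(L_1) \ge \mathit{strat}(L_2)$. **Maximal correct typing.** Given a stratification $\mathit{strat}$ with $k$ strata, for $1 \le i \le k$ let $\mathbf{L}_i = \{L \in \mathbf{L} \mid \mathit{strat}(L) \le i\}$ and let $\mathbf{S}_i = (\mathbf{L}_i, \mathbf{def}_i)$ with $\mathbf{def}_i$ the restriction of $\mathbf{def}$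 to $\mathbf{L}_i$. For a typing $t$, let $t_{|\mathbf{L}_i} = \{(n,L) \in t \mid L \in \mathbf{L}_i\}$. Define $\mathit{typing}_1$ as the maximal correct typing of $\mathbf{G}$ by $\mathbf{S}_1$, i.e. the union of all correct typings of $\mathbf{G}$ by $\mathbf{S}_1$; and for $1 \le i < k$, $\mathit{typing}_{i+1}$ as the union of all correct typings $t'$ of $\mathbf{G}$ by $\mathbf{S}_{i+1}$ such that $t'_{|\mathbf{L}_i} = \mathit{typing}_i$. Set $\mathit{Typing}(\mathbf{G},\mathbf{S},\mathit{strat}) = \mathit{typing}_k$. This does not depend on the choice of the stratification $\mathit{strat}$ of $\mathbf{S}$, and $\mathit{Typing}(\mathbf{G},\mathbf{S})$ denotes the common value. **The algorithm $\mathit{prove}$.** For a node $n$ and a label $L$, let $\mathit{dep}(n,L)$ be the set of pairs $(n',L')$ such that $(n,p,n') \in \mathit{neigh}(n)$ for some $p \in \mathsf{IRI}$ and $L'$ appears as a shape reference in $\mathbf{def}(L)$. The recursive procedure $\mathit{prove}(n,L,\mathit{Hyp})$ takes a node $n$ of $\mathbf{G}$, a label $L \in \mathbf{L}$, and a stack $\mathit{Hyp}$ of elements of $\mathrm{Nodes}(\mathbf{G}) \times \mathbf{L}$ (also regarded as the set of its elements), and does the following ($\mathbf{G}$ and $\mathbf{S}$ are global): 1. push $(n,L)$ on $\mathit{Hyp}$; 2. set $\mathit{Dep} := \emptyset$; 3. for each $(n',L') \in \mathit{dep}(n,L) \setminus \mathit{Hyp}$: if $\mathit{prove}(n',L',\mathit{Hyp})$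 returns true, then set $\mathit{Dep} := \mathit{Dep} \cup \{(n',L')\}$; 4. set $\mathit{result}$ to the truth value of $\mathit{Dep} \cup \mathit{Hyp}, n \vdash \mathbf{def}(L)$; 5. pop $\mathit{Hyp}$ and return $\mathit{result}$. *)

(* Defs.v *)
From mathcomp Require Import all_boot.
From mathcomp Require Import boolp classical_sets functions cardinality.

Set Implicit Arguments.
Unset Strict Implicit.
Unset Printing Implicit Defensive.

Local Open Scope classical_set_scope.

Section Syntax.
Variables IRI Lit Blank Lab : Type.

(* The three sets are disjoint because they are injected in a disjoint sum. *)
Definition resource := (IRI + Blank)%type.
Definition term := (resource + Lit)%type.
Definition triple := (resource * IRI * term)%type.

(* Value descriptions are subsets of IRI + Lit + {_b}. *)
Inductive vconst := VIri of IRI | VLit of Lit | VBlank.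

(* Boolean predicates encode the decidability of membership in P and V;
   an upper bound None in a repetition stands for the unbounded case. *)
Inductive texpr :=
| TArc of pred IRI & Lab
| TEmpty
| TAlt of texpr & texpr
| TSeq of texpr & texpr
| TRep of texpr & nat & option nat.

Inductive shexpr :=
| SVal of pred vconst
| STriples of texpr
| SAnd of shexpr & shexpr
| SOr of shexpr & shexpr
| SNot of shexpr.

Definition is_literal (S : shexpr) : bool :=
  match S with
  | SVal _ | STriples _ | SNot (SVal _) | SNot (STriples _) => true
  | _ => false
  end.

Fixpoint is_conj (S : shexpr) : bool :=
  if S is SAnd S1 S2 then is_conj S1 && is_conj S2 else is_literal S.

Fixpoint is_dnf (S : shexpr) : bool :=
  if S is SOr S1 S2 then is_dnf S1 && is_dnf S2 else is_conj S.

Fixpoint trefs (E : texpr) : seq Lab :=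
  match E with
  | TArc _ L => [:: L]
  | TEmpty => [::]
  | TAlt E1 E2 | TSeq E1 E2 => trefs E1 ++ trefs E2
  | TRep E1 _ _ => trefs E1
  end.

Fixpoint refs (S : shexpr) : seq Lab :=
  match S with
  | SVal _ => [::]
  | STriples E => trefs E
  | SAnd S1 S2 | SOr S1 S2 => refs S1 ++ refs S2
  | SNot S1 => refs S1
  end.

(* Labels having at least one occurrence below a negation. *)
Fixpoint neg_refs (S : shexpr) : seq Lab :=
  match S with
  | SVal _ | STriples _ => [::]
  | SAnd S1 S2 | SOr S1 S2 => neg_refs S1 ++ neg_refs S2
  | SNot S1 => refs S1
  end.

End Syntax.

Arguments TEmpty {IRI Lab}.
Arguments VIri {IRI Lit}.
Arguments VLit {IRI Lit}.
Arguments VBlank {IRI Lit}.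

Section Satisfaction.
Variables IRI Lit Blank Lab : Type.
Local Notation term := (term IRI Lit Blank).
Local Notation triple := (triple IRI Lit Blank).
Local Notation texpr := (texpr IRI Lab).
Local Notation shexpr := (shexpr IRI Lit Lab).

Definition nodes (G : set triple) : set term :=
  [set x | exists s p o, G (s, p, o) /\ (x = inl s \/ x = o)].

Definition neigh (G : set triple) (n : term) : set triple :=
  [set tr | G tr /\ inl tr.1.1 = n].

Definition vsat (V : pred (vconst IRI Lit)) (n : term) : Prop :=
  match n with
  | inl (inl i) => V (VIri i)
  | inl (inr _) => V VBlank
  | inr l => V (VLit l)
  end.

Fixpoint tsat (t : set (term * Lab)) (N : set triple) (E : texpr) : Prop :=
  match E with
  | TArc P L => exists s p o, [/\ N = [set (s, p, o)], P p & t (o, L)]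
  | TEmpty => N = set0
  | TAlt E1 E2 => tsat t N E1 \/ tsat t N E2
  | TSeq E1 E2 => exists N1 N2,
      [/\ N = N1 `|` N2, N1 `&` N2 = set0, tsat t N1 E1 & tsat t N2 E2]
  | TRep E1 min max => exists k,
      [/\ min <= k, (if max is Some m then k <= m else true) &
          exists F : 'I_k -> set triple,
            [/\ N = \bigcup_j F j, trivIset setT F &
                forall j, tsat t (F j) E1]]
  end.

Fixpoint ssat (G : set triple) (t : set (term * Lab)) (n : term) (S : shexpr)
    : Prop :=
  match S with
  | SVal V => vsat V n
  | STriples E => tsat t (neigh G n) E
  | SAnd S1 S2 => ssat G t n S1 /\ ssat G t n S2
  | SOr S1 S2 => ssat G t n S1 \/ ssat G t n S2
  | SNot S1 => ~ ssat G t n S1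
  end.

(* Correct typings of G by the restriction of the schema to the labels Ls. *)
Definition correct_typing (G : set triple) (def : Lab -> shexpr) (Ls : set Lab)
    (t : set (term * Lab)) : Prop :=
  t `<=` nodes G `*` Ls /\
  forall n L, t (n, L) -> ssat G t n (def L).

End Satisfaction.

Section Stratification.
Variables (IRI Lit : Type) (Lab : eqType).
Variable def : Lab -> shexpr IRI Lit Lab.

Definition dep_neg (L1 L2 : Lab) : bool := L2 \in neg_refs (def L1).

Definition dep_pos (L1 L2 : Lab) : bool :=
  (L2 \in refs (def L1)) && (L2 \notin neg_refs (def L1)).

Definition stratification (k : nat) (strat : Lab -> nat) : Prop :=
  [/\ 1 <= k,
      forall L, 1 <= strat L <= k,
      forall L1 L2, dep_neg L1 L2 -> strat L2 < strat L1 &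
      forall L1 L2, dep_pos L1 L2 -> strat L2 <= strat L1].

End Stratification.

Section MaximalTyping.
Variables IRI Lit Blank Lab : Type.
Local Notation term := (term IRI Lit Blank).
Local Notation triple := (triple IRI Lit Blank).
Variables (G : set triple) (def : Lab -> shexpr IRI Lit Lab).
Variable strat : Lab -> nat.

Definition labels_upto (i : nat) : set Lab := [set L | strat L <= i].

Definition restrict (t : set (term * Lab)) (Ls : set Lab) : set (term * Lab) :=
  [set q | t q /\ Ls q.2].

(* Strata are numbered from 1; the value at 0 is a dummy. *)
Fixpoint typing_upto (i : nat) : set (term * Lab) :=
  match i with
  | 0 => set0
  | j.+1 =>
    if j is 0 then
      \bigcup_(t in correct_typing G def (labels_upto 1)) t
    else
      \bigcup_(t in [set t | correct_typing G def (labels_upto j.+1) t /\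
                             restrict t (labels_upto j) = typing_upto j]) t
  end.

End MaximalTyping.

Section Prove.
Variables (IRI Lit Blank Lab : eqType).
Local Notation term := (term IRI Lit Blank).
Local Notation triple := (triple IRI Lit Blank).
Variables (G : set triple) (def : Lab -> shexpr IRI Lit Lab).

Definition dep (n : term) (L : Lab) : set (term * Lab) :=
  [set q | (exists s p, neigh G n (s, p, q.1)) /\ q.2 \in refs (def L)].

(* An order in which the loop of a call with node n, label L and stack Hyp
   (after the push) may visit dep n L minus Hyp. In a run started from the
   empty stack no two calls have the same stack, so letting the order depend
   on these data accounts for every possible execution. *)
Definition iteration_order
    (order : term -> Lab -> seq (term * Lab) -> seq (term * Lab)) : Prop :=
  forall n L Hyp, uniq (order n L Hyp) /\
    forall q, q \in order n L Hyp <-> dep n L q /\ q \notin Hyp.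

Variable order : term -> Lab -> seq (term * Lab) -> seq (term * Lab).

(* fuel bounds the recursion depth; None means that it was exhausted.
   The pop is implicit because the stack is passed by value. *)
Fixpoint prove (fuel : nat) (n : term) (L : Lab) (Hyp : seq (term * Lab))
    : option bool :=
  if fuel is fuel'.+1 then
    let Hyp1 := (n, L) :: Hyp in
    let visit oDep q :=
      obind (fun Dep : set (term * Lab) =>
        omap (fun r : bool => if r then Dep `|` [set q] else Dep)
          (prove fuel' q.1 q.2 Hyp1)) oDep in
    omap (fun Dep => `[< ssat G (Dep `|` [set` Hyp1]) n (def L) >])
      (foldl visit (Some set0) (order n L Hyp1))
  else None.

(* The evaluation terminates with result b. *)
Definition prove_returns (n : term) (L : Lab) (Hyp : seq (term * Lab))
    (b : bool) : Prop :=
  exists fuel, prove fuel n L Hyp = Some b.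

End Prove.

(* Main.v *)
(** The evaluation of [prove q Hyp] computes membership of [q] in the greatest
    fixpoint, within the stratum of [q], of "satisfied when [Hyp] is assumed".
    Writing [G H] for that fixpoint under the assumptions [H], the parameterized
    coinduction principle says that [q] is in [G H] iff [q] is in
    [G (H + {q})], which is exactly what one unfolding of [prove] tests.
    Strata never increase along the stack, so a label occurring under a
    negation is never assumed, and the assumptions made for higher strata are
    irrelevant to lower ones; there [G H] is the maximal typing. *)
Require Import Defs.
From mathcomp Require Import all_boot.
From mathcomp Require Import boolp classical_sets functions cardinality.

Set Implicit Arguments.
Unset Strict Implicit.
Unset Printing Implicit Defensive.

Local Open Scope classical_set_scope.

(** * Monotonicity of satisfaction in the typing *)

Section Monotonicity.
Variables IRI Lit Blank : Type.

Lemma tsat_mono (Lab : eqType) (t t' : set (term IRI Lit Blank * Lab))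
    (N : set (triple IRI Lit Blank)) (E : texpr IRI Lab) :
  (forall s p o L, N (s, p, o) -> L \in trefs E -> t (o, L) -> t' (o, L)) ->
  tsat t N E -> tsat t' N E.
Proof.
elim: E N => [P L||E1 IH1 E2 IH2|E1 IH1 E2 IH2|E IH min max] N /= tt'.
- move=> [s [p [o [NE Pp to]]]]; exists s, p, o; split=> //.
  by apply: (tt' s p) to; [rewrite NE | rewrite mem_head].
- by [].
- case=> [/IH1|/IH2] tE; [left|right]; apply: tE => s p o L Ns LE;
    by apply: tt' Ns _; rewrite mem_cat LE ?orbT.
- move=> [N1 [N2 [NE N12 t1 t2]]]; exists N1, N2; split=> //.
    apply: IH1 t1 => s p o L Ns LE; apply: (tt' s p); last by rewrite mem_cat LE.
    by rewrite NE; left.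
  apply: IH2 t2 => s p o L Ns LE.
  apply: (tt' s p); last by rewrite mem_cat LE orbT.
  by rewrite NE; right.
- move=> [j [minj jmax [F [NE trivF tF]]]]; exists j; split=> //.
  exists F; split=> // i; apply: IH (tF i) => s p o L Fs; apply: (tt' s p).
  by rewrite NE; exists i.
Qed.

Lemma neg_refs_refs (Lab : eqType) (S : shexpr IRI Lit Lab) :
  {subset neg_refs S <= refs S}.
Proof.
elim: S => [||S1 IH1 S2 IH2|S1 IH1 S2 IH2|S _] L //=;
  by rewrite !mem_cat => /orP[/IH1|/IH2] ->; rewrite ?orbT.
Qed.

(** A label below a negation is also listed in [refs], so both hypotheses apply to it and the two
    typings agree there. Crossing a [NOT] swaps the typings, which is why the induction generalizes
    over both. *)
Lemma ssat_mono (Lab : eqType) (G : set (triple IRI Lit Blank))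
    (t t' : set (term IRI Lit Blank * Lab)) n (S : shexpr IRI Lit Lab) :
  (forall s p o L, neigh G n (s, p, o) -> L \in refs S ->
    t (o, L) -> t' (o, L)) ->
  (forall s p o L, neigh G n (s, p, o) -> L \in neg_refs S ->
    t' (o, L) -> t (o, L)) ->
  ssat G t n S -> ssat G t' n S.
Proof.
elim: S t t' => [V|E|S1 IH1 S2 IH2|S1 IH1 S2 IH2|S IH] t t' //= pos neg.
- exact: tsat_mono.
- move=> [t1 t2]; split.
    apply: IH1 t1 => s p o L Ns LS; [apply: pos Ns _|apply: neg Ns _];
      by rewrite mem_cat LS.
  apply: IH2 t2 => s p o L Ns LS; [apply: pos Ns _|apply: neg Ns _];
    by rewrite mem_cat LS orbT.
- move=> [t1|t2]; [left|right].
    apply: IH1 t1 => s p o L Ns LS; [apply: pos Ns _|apply: neg Ns _];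
      by rewrite mem_cat LS.
  apply: IH2 t2 => s p o L Ns LS; [apply: pos Ns _|apply: neg Ns _];
    by rewrite mem_cat LS orbT.
- apply: contra_not; apply: IH => s p o L Ns LS; first exact: neg Ns LS.
  exact/(pos s p)/neg_refs_refs.
Qed.

End Monotonicity.

(** * Greatest fixpoints inside one stratum *)

Section StratifiedFixpoint.
Variables (IRI Lit Blank Lab : eqType) (G : set (triple IRI Lit Blank)).
Variable def : Lab -> shexpr IRI Lit Lab.
Variables (k : nat) (strat : Lab -> nat).
Hypothesis strat_ok : stratification def k strat.
Local Notation pair := (term IRI Lit Blank * Lab)%type.
Local Notation typing := (typing_upto G def strat).

Lemma dep_strat n L q : dep G def n L q -> strat q.2 <= strat L.
Proof.
have [_ _ neg pos] := strat_ok; move=> [_ qL].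
have [qn|qn] := boolP (q.2 \in neg_refs (def L)); first exact/ltnW/neg.
by apply: pos; rewrite /dep_pos qL.
Qed.

Lemma dep_nodes n L q : dep G def n L q -> nodes G q.1.
Proof.
by move=> [[s [p [/= Gq _]]] _]; exists s, p, q.1; split=> //; right.
Qed.

(** Negated references have strictly smaller stratum, so only there must the two typings agree. *)
Lemma ssat_strat_mono (t t' : set pair) n L :
  (forall q, dep G def n L q -> t q -> t' q) ->
  (forall q, dep G def n L q -> strat q.2 < strat L -> t' q -> t q) ->
  ssat G t n (def L) -> ssat G t' n (def L).
Proof.
have [_ _ neg _] := strat_ok; move=> pos negt.
apply: ssat_mono => s p o L' Ns L'L.
  by apply: pos; split=> //; exists s, p.
apply: negt; last exact: neg.
by split; [exists s, p|exact: neg_refs_refs].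
Qed.

(** These are the post-fixpoints at stratum [i]: lower strata are frozen at their final typing, and
    pairs of [H] may be used without being justified. *)
Definition supported (i : nat) (H X : set pair) : Prop :=
  forall n L, X (n, L) ->
    [/\ nodes G n, strat L = i &
        ssat G (typing i.-1 `|` X `|` H) n (def L)].

Definition max_supported (i : nat) (H : set pair) : set pair :=
  \bigcup_(X in supported i H) X.

Lemma max_supported_strat i H q : max_supported i H q -> strat q.2 = i.
Proof. by case: q => n L [X XH /XH[]]. Qed.

(** Passing from one supported [X] to the union adds pairs of stratum [i] only, and [H] lies at or
    above [i]; nothing changes below [i], where negated references live. *)
Lemma max_supported_supported i H :
  (forall q, H q -> i <= strat q.2) -> supported i H (max_supported i H).
Proof.
move=> Hi n L [X XH Xn]; have [nG Li Xsat] := XH _ _ Xn; split=> //.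
apply: ssat_strat_mono Xsat => q _.
  by move=> [[Tq|Xq]|Hq]; [left; left|left; right; exists X|right].
rewrite Li => qi [[Tq|/max_supported_strat qE]|/Hi]; first by left; left.
  by rewrite qE ltnn in qi.
by rewrite leqNgt qi.
Qed.

(** Labels of stratum [i] refer to strata at most [i], so assumptions above [i] are never consulted
    and need not be compared. *)
Lemma max_supported_mono i H H' :
  (forall q, H' q -> i <= strat q.2) ->
  (forall q, strat q.2 <= i -> H q -> H' q) ->
  max_supported i H `<=` max_supported i H'.
Proof.
move=> H'i HH' q [X XH Xq]; exists X => // n L Xn.
have [nG Li Xsat] := XH _ _ Xn; split=> //.
apply: ssat_strat_mono Xsat => q' dq'.
  move=> [?|?]; [by left|right; apply: HH' => //].
  by rewrite -Li; exact: dep_strat dq'.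
by rewrite Li => q'i [?|/H'i]; [left|rewrite leqNgt q'i].
Qed.

Lemma max_supported_unfold i H n L :
  (forall q, H q -> i <= strat q.2) -> nodes G n -> strat L = i ->
  let H' := (n, L) |` H in
  max_supported i H (n, L) <->
  ssat G (typing i.-1 `|` max_supported i H' `|` H') n (def L).
Proof.
move=> Hi nG Li H'.
have H'i q : H' q -> i <= strat q.2 by move=> [->|/Hi //]; rewrite Li.
split=> [GH|sat].
  have [_ _] := max_supported_supported Hi GH.
  apply: ssat_strat_mono => q _.
    move=> [[Tq|Gq]|Hq]; [by left; left|left; right|by right; right].
    by apply: max_supported_mono Gq => // q' _; right.
  rewrite Li => qi [[Tq|/max_supported_strat qE]|/H'i].
  - by left; left.
  - by rewrite qE ltnn in qi.
  - by rewrite leqNgt qi.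
(* The pair moves from the assumptions into the supported set; the total set against which
   satisfaction is tested stays the same. *)
exists ((n, L) |` max_supported i H'); last by left.
have setE : typing i.-1 `|` ((n, L) |` max_supported i H') `|` H =
            typing i.-1 `|` max_supported i H' `|` H'.
  rewrite /H' -!setUA; congr (_ `|` _).
  by rewrite setUCA.
move=> n' L'; rewrite setE => -[[-> ->]//|].
exact: (max_supported_supported H'i).
Qed.

(** Strata start at 1, so restricting to strata up to 0 leaves the empty set and the first stage
    obeys the general clause. *)
Lemma typing_uptoS i : typing i.+1 =
  \bigcup_(t in [set t | correct_typing G def (labels_upto strat i.+1) t /\
    Defs.restrict t (labels_upto strat i) = typing i]) t.
Proof.
case: i => [|//] /=; congr bigcup; apply/seteqP; split=> [t tc|t []//].
split=> //; apply/seteqP; split=> // -[n L] [tn].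
have [_ /(_ L)] := strat_ok; rewrite /labels_upto /=.
by case: (strat L).
Qed.

(** The two claims feed each other: correctness at one stage identifies the next stage, whose
    correctness then follows. *)
Lemma typing_upto_correct i :
  correct_typing G def (labels_upto strat i) (typing i) /\
  typing i.+1 = typing i `|` max_supported i.+1 set0.
Proof.
have GS j : supported j.+1 set0 (max_supported j.+1 set0)
  by exact: max_supported_supported.
have step j : correct_typing G def (labels_upto strat j) (typing j) ->
  correct_typing G def (labels_upto strat j.+1)
    (typing j `|` max_supported j.+1 set0).
  move=> [tS tsat]; split=> [[n L] /= [tn|Gn]|n L [tn|Gn]].
  - by have [? /= /leqW] := tS _ tn.
  - by have [? Lj _] := GS _ _ _ Gn; rewrite /labels_upto /= Lj.
  - have [_ /= Lj] := tS _ tn.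
    apply: ssat_strat_mono (tsat _ _ tn) => q dq; first by left.
    move=> _ [//|/max_supported_strat qE].
    by have := leq_trans (dep_strat dq) Lj; rewrite qE ltnn.
  - by have [_ _] := GS _ _ _ Gn; rewrite setU0.
have stepE j : correct_typing G def (labels_upto strat j) (typing j) ->
    typing j.+1 = typing j `|` max_supported j.+1 set0.
  move=> tj; rewrite typing_uptoS; apply/seteqP; split=> q; last first.
    exists (typing j `|` max_supported j.+1 set0) => //; split; first exact: step.
    apply/seteqP; split=> [q' [[//|/max_supported_strat q'E]]|q' tq'].
      by rewrite /labels_upto /= q'E ltnn.
    by split; [left|exact: (tj.1 _ tq').2].
  move=> [t [[tS tsat] tE] tq].
  have [qj|qj] := leqP (strat q.2) j; first by left; rewrite -tE.
  (* The slice of [t] at the new stratum is supported, since the rest of [t] is exactly the previous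
     stage. *)
  right; exists (t `&` [set q' | strat q'.2 = j.+1]); last first.
    by split=> //; apply/eqP; rewrite eqn_leq qj andbT; exact: (tS _ tq).2.
  move=> n L [tn Lj]; split=> //; first exact: (tS _ tn).1.
  rewrite setU0 /= -tE; apply: ssat_strat_mono (tsat _ _ tn) => q' _; last first.
    by move=> _ [] [].
  move=> tq'; have [q'j|q'j] := leqP (strat q'.2) j; [by left|right].
  by split=> //; apply/eqP; rewrite eqn_leq q'j andbT; exact: (tS _ tq').2.
suff tc : correct_typing G def (labels_upto strat i) (typing i).
  by split=> //; exact: stepE.
by elim: i => [|i IH]; [split|rewrite stepE //; exact: step].
Qed.

(** Each stage adds only pairs of its own stratum, so membership is settled once stage [strat L] is
    reached. *)
Lemma typing_uptoE i n L : strat L <= i ->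
  typing i (n, L) <-> max_supported (strat L) set0 (n, L).
Proof.
elim: i => [|i IH].
  by have [_ /(_ L)] := strat_ok; case: (strat L).
have [[tS _] ->] := typing_upto_correct i.
rewrite leq_eqVlt ltnS => /predU1P[Li|Li].
  rewrite Li; split=> [[/tS[_]|//]|]; last by right.
  by rewrite /labels_upto /= Li ltnn.
split=> [[/(IH Li)//|/max_supported_strat /= LE]|/(IH Li)]; last by left.
by rewrite LE ltnn in Li.
Qed.

End StratifiedFixpoint.

(** This removes the visiting order from the argument: when all calls return, the result of the loop
    depends only on which pairs are visited. *)
Lemma foldl_visit (T : eqType) (f : T -> option bool) (b : T -> bool)
    (s : seq T) (D : set T) :
  {in s, forall q, f q = Some (b q)} ->
  foldl (fun oD q => obind (fun D : set T =>
      omap (fun r : bool => if r then D `|` [set q] else D) (f q)) oD)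
    (Some D) s =
  Some (D `|` [set q | q \in s /\ b q]).
Proof.
elim: s D => [|q s IH] D fb /=.
  by congr Some; apply/seteqP; split=> [q|q []//]; [left|case].
rewrite fb ?mem_head //= IH => [|q' q's]; last by rewrite fb // inE q's orbT.
congr Some; apply/seteqP; split=> q'.
- case: ifP => bq; [move=> [[Dq|->]|[q's bq']]|move=> [Dq|[q's bq']]];
    by [left|right; rewrite /= inE ?eqxx // q's orbT].
- move=> [Dq|/= []]; first by case: ifP => _; left => //; left.
  rewrite inE => /predU1P[-> ->|q's bq']; first by left; right.
  by case: ifP; right.
Qed.

Lemma finite_nodes (IRI Lit Blank : eqType) (G : set (triple IRI Lit Blank)) :
  finite_set G -> finite_set (nodes G).
Proof.
move=> finG.
have -> : nodes G = (fun tr => inl tr.1.1) @` G `|` snd @` G.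
  apply/seteqP; split=> [x [s [p [o [Gt [->|->]]]]]|x].
  - by left; exists (s, p, o).
  - by right; exists (s, p, o).
  - by move=> [|] [[[s p] o] Gt <-]; exists s, p, o; split=> //; [left|right].
by rewrite finite_setU; split; exact: finite_image.
Qed.

(** * Termination and correctness of [prove] *)

Section Correctness.
Variables (IRI Lit Blank Lab : eqType) (G : set (triple IRI Lit Blank)).
Variable def : Lab -> shexpr IRI Lit Lab.
Variables (k : nat) (strat : Lab -> nat).
Hypothesis strat_ok : stratification def k strat.
Local Notation pair := (term IRI Lit Blank * Lab)%type.
Variable order : term IRI Lit Blank -> Lab -> seq pair -> seq pair.
Hypothesis order_ok : iteration_order G def order.

(** The stack is duplicate-free inside the finite [E] and grows at each call, which bounds the
    recursion. The stratum invariant on [Hyp] is what the fixpoint lemmas require of assumptions. *)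
Lemma proveE (E : seq pair) (fuel : nat) n L Hyp :
  (forall q : pair, nodes G q.1 -> q \in E) ->
  nodes G n -> uniq Hyp -> {subset Hyp <= E} -> (n, L) \notin Hyp ->
  {in Hyp, forall q, strat L <= strat q.2} ->
  size E < fuel + size Hyp ->
  prove G def order fuel n L Hyp =
  Some `[< max_supported G def strat (strat L) [set` Hyp] (n, L) >].
Proof.
move=> allE; elim: fuel n L Hyp => [|fuel IH] n L Hyp nG uH HE nH sH fuelE.
  by move: fuelE; rewrite ltnNge uniq_leq_size.
set H1 := (n, L) :: Hyp.
have sH1 : {in H1, forall q, strat L <= strat q.2}.
  by move=> q; rewrite inE => /predU1P[->|/sH].
have [_ orderE] := order_ok n L H1.
have H1E : [set` H1] = (n, L) |` [set` Hyp].
  apply/seteqP; split=> q /=; rewrite inE; first by move=> /predU1P[]; [left|right].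
  by move=> [->|/= ->]; rewrite ?eqxx ?orbT.
rewrite /= -/H1.
rewrite (foldl_visit _
  (b := fun q => `[< max_supported G def strat (strat q.2) [set` H1] q >])); last first.
  move=> [n' L'] /orderE[dq qH1] /=; apply: IH => //=.
  - exact: dep_nodes dq.
  - by rewrite nH uH.
  - by move=> q; rewrite inE => /predU1P[->|/HE //]; exact: allE.
  - by move=> q /sH1; apply: leq_trans; exact: (dep_strat strat_ok dq).
  - by rewrite addnS -addSn.
congr Some; apply: asbool_equiv_eq.
have Hi q : [set` Hyp] q -> strat L <= strat q.2 by exact: sH.
rewrite (max_supported_unfold strat_ok Hi nG erefl).
rewrite -H1E set0U.
set T := typing_upto _ _ _ _.
(* Satisfaction consults only pairs of [dep n L], so agreement is checked there: on the stack, at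
   the stratum of [L], or strictly below it. *)
have agree q : dep G def n L q ->
    ([set q | q \in order n L H1 /\
       `[< max_supported G def strat (strat q.2) [set` H1] q >]] `|` [set` H1]) q
    <-> (T `|` max_supported G def strat (strat L) [set` H1] `|` [set` H1]) q.
  move=> dq; case: (boolP (q \in H1)) => qH1; first by split; right.
  have qo : q \in order n L H1 by apply/orderE.
  have := dep_strat strat_ok dq.
  rewrite leq_eqVlt => /predU1P[qL|qL].
    (* Since [strat L] is positive, the predecessor in [T] is a true decrement and [T] stays
       strictly below [strat L]. *)
    have Tq : ~ T q.
      have [[tS _] _] := typing_upto_correct G strat_ok (strat L).-1.
      move=> /tS[_]; rewrite /labels_upto /= qL.
      have [_ /(_ L)] := strat_ok; case: (strat L) => // i _ _ _.
      by rewrite ltnn.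
    rewrite -qL; split.
      by move=> [[_ /asboolP]|]; [left; right|right].
    move=> [[//|Gq]|]; [left|by right].
    by split=> //; apply/asboolP.
  have -> : (T `|` max_supported G def strat (strat L) [set` H1] `|` [set` H1]) q
     <-> T q.
    split; last by left; left.
    move=> [[//|/max_supported_strat qE]|/= /(negP qH1)//].
    by rewrite qE ltnn in qL.
  case: q {dq} qH1 qo qL => n' L' /= qH1 qo qL.
  rewrite /T (typing_uptoE G strat_ok); last by case: (strat L) qL.
  (* Every assumption on the stack is strictly above [strat L'], so dropping them all changes
     nothing and the call computes the final typing. *)
  have sub : max_supported G def strat (strat L') [set` H1] (n', L') <->
             max_supported G def strat (strat L') set0 (n', L').
    have lt q : q \in H1 -> strat L' < strat q.2.
      by move=> /sH1; exact: leq_trans.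
    split; apply: (max_supported_mono strat_ok) => //= q.
    - by move=> qL' /lt; rewrite ltnNge qL'.
    - by move=> /lt /ltnW.
  rewrite -sub; split=> [[[_ /asboolP]//|/= /(negP qH1)//]|Gq].
  by left; split=> //; apply/asboolP.
split; apply: (ssat_strat_mono strat_ok) => // q dq; first by move/(agree q dq).
all: by move=> *; apply/(agree q dq).
Qed.

End Correctness.

Theorem proposition2 (IRI Lit Blank : eqType) (Lab : finType)
  (G : set (triple IRI Lit Blank)) (finG : finite_set G)
  (def : Lab -> shexpr IRI Lit Lab) (def_dnf : forall L, is_dnf (def L))
  (k : nat) (strat : Lab -> nat) (strat_ok : stratification def k strat)
  (order : term IRI Lit Blank -> Lab -> seq (term IRI Lit Blank * Lab) ->
           seq (term IRI Lit Blank * Lab))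
  (order_ok : iteration_order G def order)
  (n : term IRI Lit Blank) (nG : nodes G n) (L : Lab) :
  exists b : bool, prove_returns G def order n L [::] b /\
    (b = true <-> typing_upto G def strat k (n, L)).
Proof.
have /finite_seqP[s sE] := finite_nodes finG.
(* All pairs that can ever be pushed; their number bounds the depth of the stack. *)
pose E := [seq (m, L') | m <- s, L' <- enum Lab].
have allE q : nodes G q.1 -> q \in E.
  case: q => m L'; rewrite sE /= => ms.
  by apply/allpairsP; exists (m, L'); rewrite mem_enum.
exists `[< max_supported G def strat (strat L) [set` [::]] (n, L) >]; split.
  exists (size E).+1; apply: (proveE strat_ok order_ok allE) => //.
  by rewrite /= addn0.
rewrite (_ : [set` [::]] = set0); last by apply/seteqP; split.
have [_ /(_ L)/andP[_ Lk] _ _] := strat_ok.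
rewrite (typing_uptoE G strat_ok) //; split=> /asboolP; exact.
Qed.
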